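(* For all $n\in\mathbb N$ and $t\in\mathbb C$ the generalized displacement polynomials satisfy $$\widetilde{\mathcal P}_n(X_1,\dots,X_n;t)=\sum_{j=1}^n(t-j+1)\cdot\widetilde{\mathcal P}_{n-j}(X_1,\dots,X_{n-j};t-j)\cdot X_j$$ and $$\widetilde{\mathcal P}_n(X_1,\dots,X_n;t)=(t-n+1)\cdot\sum_{j=1}^nX_j\cdot\widetilde{\mathcal P}_{n-j}(X_1,\dots,X_{n-j};t).$$
   Context: $X_1,X_2,\dots$ are free noncommutative variables and $I$ is the unit of the free associative algebra $\mathbb C\langle X_1,X_2,\dots\rangle$. The generalized displacement polynomials are $\widetilde{\mathcal P}_0:=I$ and, for $i\in\mathbb N$, $t\in\mathbb C$, $\widetilde{\mathcal P}_i(X_1,\dots,X_i;t)=\sum_{i_1+\cdots+i_k=i}p_{i_1,\dots,i_k}(t)\,X_{i_k}\cdots X_{i_1}$, where the sum runs over all $k\in\{1,\dots,i\}$ and all $(i_1,\dots,i_k)\in\mathbb N^k$ with sum $i$, and $p_{i_1,\dots,i_k}(t)=(t-i_1+1)(t-i_1-i_2+1)\cdots(t-i_1-\cdots-i_k+1)$. *)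

(* Defs.v *)
From HB Require Import structures.
From mathcomp Require Import all_boot all_order all_algebra.
From mathcomp Require Import reals.
From mathcomp Require Import complex.
From mathcomp Require Import monalg.

Set Implicit Arguments.
Unset Strict Implicit.
Unset Printing Implicit Defensive.

Import GRing.Theory.
Local Open Scope ring_scope.
Local Open Scope complex_scope.

(* The monoid algebra of the free monoid {fmonom nat}; the letter m stands for
   the variable X_(m+1). *)
Definition freeAlg (R : realType) := {malg R[i][{fmonom nat}]}.

(* The variables are X_1, X_2, ...; the value at i = 0 is junk. *)
Definition Xvar (R : realType) (i : nat) : freeAlg R := << fmu i.-1 >>.

(* (t - i_1 + 1) (t - i_1 - i_2 + 1) ... (t - i_1 - ... - i_k + 1)
   for c = (i_1, ..., i_k). *)
Definition pcoef (R : realType) (c : seq nat) (t : R[i]) : R[i] :=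
  \prod_(0 <= l < size c) (t - (sumn (take l.+1 c))%:R + 1).

(* X_{i_k} ... X_{i_1} for c = (i_1, ..., i_k). *)
Definition Xword (R : realType) (c : seq nat) : freeAlg R :=
  \prod_(i <- rev c) Xvar R i.

Definition is_composition (n : nat) (c : seq nat) : bool :=
  all (fun i => 0 < i)%N c && (sumn c == n).

(* Every part of a composition of n is at most n, so letting the parts range
   over 'I_n.+1 loses nothing. *)
Definition displacement (R : realType) (n : nat) (t : R[i]) : freeAlg R :=
  if n == 0%N then 1 else
  \sum_(1 <= k < n.+1)
    \sum_(c : k.-tuple 'I_n.+1 | is_composition n (map val c))
      pcoef (map val c) t *: Xword R (map val c).

(* Main.v *)
Require Import Defs.
From mathcomp Require Import all_boot all_order all_algebra.
From mathcomp Require Import reals.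
From mathcomp Require Import complex.
From mathcomp Require Import monalg.

(** Both recursions sort the compositions [(i_1, ..., i_k)] of [n] by one part:
    splitting off [i_1 = j] removes the factor [t - j + 1] and shifts [t] to
    [t - j] in the others, while splitting off [i_k = j] removes the factor
    [t - n + 1] and leaves the others alone. *)

Set Implicit Arguments.
Unset Strict Implicit.
Unset Printing Implicit Defensive.

Local Open Scope ring_scope.
Local Open Scope complex_scope.
Import GRing.Theory.

(** Plain sequences let compositions of [n] and of [n - j] be compared, which tuples over ['I_n.+1]
    do not. Lengths start at 0 so that the empty composition covers [n = 0]. *)
Definition compositions (n : nat) : seq (seq nat) :=
  [seq map val (tval c) | k <- iota 0 n.+1,
    c <- [seq c : k.-tuple 'I_n.+1 <- index_enum _ | is_composition n (map val c)]].

Definition displacement_term (R : realType) (t : R[i]) (c : seq nat) : freeAlg R :=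
  pcoef c t *: Xword R c.

Lemma is_composition_cons n j c :
  is_composition n (j :: c) =
  [&& (0 < j)%N, (j <= n)%N & is_composition (n - j) c].
Proof.
rewrite /is_composition /= -!andbA; case: (0 < j)%N => //=.
case: leqP => [le_jn | lt_nj] /=; first by rewrite -[in RHS](eqn_add2l j) subnKC.
by rewrite gtn_eqF ?andbF // ltn_addr.
Qed.

(** Positivity of the parts and their sum ignore order, so the criterion for a first part also
    serves for a last one. *)
Lemma is_composition_rcons n j c :
  is_composition n (rcons c j) = is_composition n (j :: c).
Proof. by rewrite /is_composition all_rcons sumn_rcons /= addnC. Qed.

Lemma is_composition_size n c : is_composition n c -> (size c <= n)%N.
Proof.
elim: c n => [//|j c IHc] n; rewrite is_composition_cons => /and3P[j_gt0 le_jn].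
move/IHc => le_c; rewrite /= -add1n -(subnKC le_jn).
exact: leq_add.
Qed.

Lemma is_composition_le n c : is_composition n c -> all (leq^~ n) c.
Proof.
elim: c n => [//|j c IHc] n; rewrite is_composition_cons => /and3P[_ le_jn].
move/IHc => le_c; rewrite /= le_jn /=.
by apply: sub_all le_c => i /leq_trans; apply; apply: leq_subr.
Qed.

Lemma compositions_uniq n : uniq (compositions n).
Proof.
apply: allpairs_uniq_dep; first exact: iota_uniq.
  by move=> k _; apply: filter_uniq; apply: index_enum_uniq.
move=> [k c] [l d] _ _ /= eq_cd.
(* Equal underlying sequences force equal lengths; only then do [c] and [d] share a type. *)
have eq_kl : k = l by rewrite -(size_tuple c) -(size_tuple d) -(size_map val c) eq_cd size_map.
case: l / eq_kl d eq_cd => d /(inj_map val_inj)/val_inj -> //.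
Qed.

Lemma mem_compositions n c : (c \in compositions n) = is_composition n c.
Proof.
apply/allpairsPdep/idP => [[k [d []]] _ | comp_c].
  by rewrite mem_filter => /andP[comp_d _] ->.
(* [inord] preserves the parts, since none exceeds [n]. *)
have val_c : map val (map (@inord n) c) = c.
  rewrite -map_comp -[RHS]map_id; apply/eq_in_map => i i_c /=.
  by rewrite inordK // ltnS; apply: (allP (is_composition_le comp_c)).
exists (size c), (map_tuple (@inord n) (in_tuple c)); split=> //.
  by rewrite mem_iota add0n ltnS is_composition_size.
by rewrite mem_filter mem_index_enum andbT /= val_c.
Qed.

Lemma displacementE (R : realType) n (t : R[i]) :
  displacement n t = \sum_(c <- compositions n) displacement_term t c.
Proof.
rewrite big_allpairs_dep /displacement.
under [RHS]eq_bigr => k _ do rewrite big_filter.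
case: eqP => [-> | /eqP n_neq0]; last first.
  (* The extra length 0 contributes nothing: the empty sequence sums to 0, not to [n]. *)
  rewrite /index_iota subn1 [RHS]big_cons [X in _ = X + _]big1 ?add0r // => c.
  by rewrite tuple0 /= /is_composition /= eq_sym (negbTE n_neq0).
(* For [n = 0] only the empty composition remains; its coefficient and its word are empty
   products. *)
rewrite big_seq1 (big_pred1 [tuple]) => [|c].
  by rewrite /displacement_term /pcoef /Xword /= big_geq // big_nil scale1r.
by rewrite tuple0 /= eqxx.
Qed.

Lemma perm_compositions (n : nat) (s : seq (seq nat)) :
  uniq s -> s =i is_composition n -> perm_eq (compositions n) s.
Proof.
move=> s_uniq mem_s; apply: uniq_perm => // [|c]; first exact: compositions_uniq.
by rewrite mem_compositions mem_s.
Qed.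

Lemma perm_compositions_cons (n : nat) : (0 < n)%N ->
  perm_eq (compositions n)
    [seq j :: c | j <- index_iota 1 n.+1, c <- compositions (n - j)].
Proof.
move=> n_gt0; apply: perm_compositions => [|c].
  apply: allpairs_uniq_dep => [|j _|[i c] [j d] _ _ /= [-> ->] //].
    exact: iota_uniq.
  exact: compositions_uniq.
rewrite -[RHS]/(is_composition n c); apply/allpairsPdep/idP => [[j [d [j_n d_n ->]]] | ].
  rewrite mem_index_iota ltnS in j_n; case/andP: j_n => j_gt0 le_jn.
  by rewrite is_composition_cons j_gt0 le_jn -mem_compositions.
(* [n > 0] excludes the empty composition, so there is a first part. *)
case: c => [|j c]; first by rewrite /is_composition /= ltn_eqF.
rewrite is_composition_cons => /and3P[j_gt0 le_jn comp_c].
by exists j, c; rewrite mem_index_iota ltnS j_gt0 le_jn mem_compositions.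
Qed.

Lemma perm_compositions_rcons (n : nat) : (0 < n)%N ->
  perm_eq (compositions n)
    [seq rcons c j | j <- index_iota 1 n.+1, c <- compositions (n - j)].
Proof.
move=> n_gt0; apply: perm_compositions => [|c].
  apply: allpairs_uniq_dep => [|j _|[i c] [j d] _ _ /= /rcons_inj[-> ->] //].
    exact: iota_uniq.
  exact: compositions_uniq.
rewrite -[RHS]/(is_composition n c); apply/allpairsPdep/idP => [[j [d [j_n d_n ->]]] | ].
  rewrite mem_index_iota ltnS in j_n; case/andP: j_n => j_gt0 le_jn.
  by rewrite is_composition_rcons is_composition_cons j_gt0 le_jn -mem_compositions.
case/lastP: c => [|c j]; first by rewrite /is_composition /= ltn_eqF.
rewrite is_composition_rcons is_composition_cons => /and3P[j_gt0 le_jn comp_c].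
by exists j, c; rewrite mem_index_iota ltnS j_gt0 le_jn mem_compositions.
Qed.

(** Every nonempty prefix of [j :: c] contains [j], so [j] shifts [t] in all later factors. *)
Lemma pcoef_cons (R : realType) j c (t : R[i]) :
  pcoef (j :: c) t = (t - j%:R + 1) * pcoef c (t - j%:R).
Proof.
rewrite /pcoef /= big_nat_recl //= take0 /= addn0; congr (_ * _).
by apply: eq_bigr => l _; rewrite natrD opprD addrA.
Qed.

(** Only the full prefix sees [j]; the shorter ones are prefixes of [c], whose factors stay
    unshifted. *)
Lemma pcoef_rcons (R : realType) j c (t : R[i]) :
  pcoef (rcons c j) t = (t - (sumn c + j)%:R + 1) * pcoef c t.
Proof.
rewrite /pcoef size_rcons big_nat_recr //= mulrC take_oversize ?size_rcons //.
rewrite sumn_rcons; congr (_ * _); rewrite big_nat_cond [RHS]big_nat_cond.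
apply: eq_bigr => l /andP[/andP[_ lt_lc] _].
by rewrite -cats1 takel_cat.
Qed.

(* The algebra structure of [malg] is declared only for commutative monoids. *)
Lemma malg_scalerAr (K : monomType) (S : comNzRingType) (a : S)
    (g h : {malg S[K]}) : a *: (g * h) = g * (a *: h).
Proof.
(* Scaling is multiplication by a constant supported at the monoid unit, which commutes with [g]. *)
rewrite -!mul_malgC !mulrA; congr (_ * _).
rewrite !malgM_def fgmulUg fgmulgU.
by apply: eq_bigr => k _; rewrite mulrC mul1m mulm1.
Qed.

(** [Xword] reverses the order, so the first part gives the rightmost variable. *)
Lemma displacement_term_cons (R : realType) j c (t : R[i]) :
  displacement_term t (j :: c) =
    ((t - j%:R + 1) *: displacement_term (t - j%:R) c) * Xvar R j.
Proof.
by rewrite /displacement_term pcoef_cons /Xword rev_cons big_rcons /= scalerA scalerAl.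
Qed.

(** The last part gives the leftmost variable, so the coefficient of [c] has to move past it. *)
Lemma displacement_term_rcons (R : realType) j c (t : R[i]) :
  displacement_term t (rcons c j) =
    (t - (sumn c + j)%:R + 1) *: (Xvar R j * displacement_term t c).
Proof.
by rewrite /displacement_term pcoef_rcons /Xword rev_rcons big_cons -malg_scalerAr scalerA.
Qed.

Theorem theorem6p2 (R : realType) (n : nat) (t : R[i]) (hn : (0 < n)%N) :
  displacement n t =
    \sum_(1 <= j < n.+1)
      ((t - j%:R + 1) *: displacement (n - j) (t - j%:R)) * Xvar R j
  /\
  displacement n t =
    (t - n%:R + 1) *:
      \sum_(1 <= j < n.+1) Xvar R j * displacement (n - j) t.
Proof.
split; rewrite displacementE.
  rewrite (perm_big _ (perm_compositions_cons hn)) big_allpairs_dep /=.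
  apply: eq_bigr => j _; rewrite displacementE scaler_sumr mulr_suml.
  by apply: eq_bigr => c _; rewrite displacement_term_cons.
rewrite (perm_big _ (perm_compositions_rcons hn)) big_allpairs_dep scaler_sumr /=.
(* The factor becomes [t - n + 1] because [c] sums to [n - j] with [j <= n], so the ranges of [j]
   and [c] are kept as hypotheses. *)
apply: eq_big_nat => j /andP[_ le_jn].
rewrite displacementE mulr_sumr scaler_sumr; apply: eq_big_seq => c.
rewrite mem_compositions => /andP[_ /eqP sum_c].
by rewrite displacement_term_rcons sum_c subnK.
Qed.
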